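(* Let $n \ge 3$ be an integer, let $F_n$ be the free group of rank $n$ on the set $\{x_1, \dots, x_n\}$, and let $\phi : F_n \to F_n$ be a primitivity preserving endomorphism of $F_n$. Then $\phi$ is an automorphism of $F_n$.
   Context: An element of $F_n$ is called primitive if it belongs to some free basis of $F_n$ (equivalently, if it equals $\psi(x_1)$ for some $\psi \in \operatorname{Aut} F_n$). An endomorphism $\phi$ of a free group is called primitivity preserving if $\phi$ takes every primitive element to a primitive element. *)

(* Defs.v *)
From HB Require Import structures.
From mathcomp Require Import all_boot.

Set Implicit Arguments.
Unset Strict Implicit.
Unset Printing Implicit Defensive.

Local Open Scope group_scope.

(* The free group on [I] consists of the reduced words over the letters
   [(i, true)], standing for the generator x_i, and [(i, false)], standing for
   its inverse. *)
Section Words.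

Variable I : choiceType.

Definition linv (a : I * bool) : I * bool := (a.1, ~~ a.2).

Definition reduced (w : seq (I * bool)) : bool :=
  sorted (fun a b => b != linv a) w.

Record free_group := FreeGroup { fgword :> seq (I * bool); _ : reduced fgword }.

HB.instance Definition _ := [isSub for fgword].
HB.instance Definition _ := [Choice of free_group by <:].

(* Left multiplication of a reduced word by one letter. *)
Definition lact (a : I * bool) (w : seq (I * bool)) : seq (I * bool) :=
  if w is b :: w' then if b == linv a then w' else a :: w else [:: a].

Definition wmul (u v : seq (I * bool)) : seq (I * bool) := foldr lact v u.

Definition winv (u : seq (I * bool)) : seq (I * bool) := rev (map linv u).

Lemma linvK : involutive linv.
Proof. by case=> i b; rewrite /linv /= negbK. Qed.

Lemma reduced_lact a w : reduced w -> reduced (lact a w).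
Proof.
case: w => [|b w] //= red_w; case: eqP => [_|/eqP neq_ba] /=.
  exact: path_sorted red_w.
by rewrite neq_ba.
Qed.

Lemma reduced_wmul u v : reduced v -> reduced (wmul u v).
Proof. by move=> red_v; elim: u => //= a u IHu; apply: reduced_lact. Qed.

Lemma reduced_winv u : reduced u -> reduced (winv u).
Proof.
rewrite /reduced /winv rev_sorted sorted_map; apply: sub_sorted => a b neq_ba.
by change (linv a != linv (linv b)); rewrite linvK eq_sym.
Qed.

Lemma lactK a w : reduced w -> lact a (lact (linv a) w) = w.
Proof.
case: w => [|b w] /=; first by rewrite eqxx.
rewrite linvK; case: eqP => [-> |_ _] /=; last by rewrite eqxx.
by case: w => [|c w] //= /andP[/negPf ->].
Qed.

Lemma wmul_lact a u w : reduced w -> wmul (lact a u) w = lact a (wmul u w).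
Proof.
case: u => [|b u] //= red_w; case: eqP => //= ->.
by rewrite lactK //; apply: reduced_wmul.
Qed.

Lemma wmulA u v w : reduced w -> wmul u (wmul v w) = wmul (wmul u v) w.
Proof. by move=> red_w; elim: u => //= a u IHu; rewrite wmul_lact // IHu. Qed.

Lemma wmulr0 u : reduced u -> wmul u [::] = u.
Proof.
elim: u => //= a u IHu red_au; rewrite IHu; last exact: path_sorted red_au.
by case: u red_au {IHu} => [|b u] //= /andP[/negPf ->].
Qed.

Lemma wmulVr u : wmul (winv u) u = [::].
Proof.
elim: u => // a u IHu.
by rewrite /winv /= rev_cons -cats1 /wmul foldr_cat /= linvK eqxx.
Qed.

Lemma winvK : involutive winv.
Proof. by move=> u; rewrite /winv map_rev revK mapK //; apply: linvK. Qed.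

Lemma wmulrV u : wmul u (winv u) = [::].
Proof. by rewrite -{1}[u]winvK wmulVr. Qed.

Definition fg_one : free_group := FreeGroup (isT : reduced [::]).
Definition fg_mul (u v : free_group) : free_group :=
  FreeGroup (reduced_wmul u (valP v)).
Definition fg_inv (u : free_group) : free_group :=
  FreeGroup (reduced_winv (valP u)).

Lemma fg_mulA : associative fg_mul.
Proof. by move=> u v w; apply/val_inj/wmulA/valP. Qed.

Lemma fg_mul1g : left_id fg_one fg_mul.
Proof. by move=> u; apply/val_inj. Qed.

Lemma fg_mulg1 : right_id fg_one fg_mul.
Proof. by move=> u; apply/val_inj/wmulr0/valP. Qed.

Lemma fg_mulVg : left_inverse fg_one fg_inv fg_mul.
Proof. by move=> u; apply/val_inj/wmulVr. Qed.

Lemma fg_mulgV : right_inverse fg_one fg_inv fg_mul.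
Proof. by move=> u; apply/val_inj/wmulrV. Qed.

HB.instance Definition _ := isGroup.Build free_group
  fg_mulA fg_mul1g fg_mulg1 fg_mulVg fg_mulgV.

Definition fg_gen (i : I) : free_group :=
  FreeGroup (isT : reduced [:: (i, true)]).

End Words.

(* [B] is a free basis of [G]: every map from [B] to a group [H] extends to a
   unique homomorphism from [G] to [H].  Since [H] is inhabited, maps from [B]
   are represented by total functions of which only the values on [B] matter. *)
Definition free_basis (G : groupType) (B : G -> Prop) : Prop :=
  forall (H : groupType) (f : G -> H),
    (exists h : {multiplicative G -> H}, forall b, B b -> h b = f b) /\
    (forall h1 h2 : {multiplicative G -> H},
       (forall b, B b -> h1 b = h2 b) -> h1 =1 h2).

Definition primitive_elt (G : groupType) (w : G) : Prop :=
  exists2 B : G -> Prop, free_basis B & B w.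

Definition primitivity_preserving (G : groupType)
    (phi : {multiplicative G -> G}) : Prop :=
  forall w : G, primitive_elt w -> primitive_elt (phi w).

(* The generators x_i do form a free basis of the group of reduced words. *)
Section Universal.

Variables (I : choiceType) (H : groupType) (f : I -> H).

Definition leval (a : I * bool) : H := if a.2 then f a.1 else (f a.1)^-1.
Definition weval (w : seq (I * bool)) : H :=
  foldr (fun a h => leval a * h) 1 w.

Lemma leval_linv a : leval (linv a) = (leval a)^-1.
Proof. by case: a => i [] //=; rewrite /leval /= invgK. Qed.

Lemma weval_lact a w : weval (lact a w) = leval a * weval w.
Proof.
by case: w => //= b w; case: eqP => //= ->; rewrite leval_linv mulgA mulgV mul1g.
Qed.

Definition fg_eval (u : free_group I) : H := weval u.

Lemma fg_eval_mul : {morph fg_eval : u v / u * v}.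
Proof.
move=> [u ru] v; rewrite /fg_eval /=; elim: u {ru} => [|a u IHu] /=.
  by rewrite mul1g.
by rewrite weval_lact IHu mulgA.
Qed.

HB.instance Definition _ :=
  isMultiplicative.Build (free_group I) H fg_eval fg_eval_mul.

End Universal.

Lemma fg_gen_free_basis (I : choiceType) :
  free_basis (fun u : free_group I => exists i, u = fg_gen i).
Proof.
move=> H f; split.
  exists (fg_eval (fun i => f (fg_gen i))) => _ [i ->].
  by rewrite /= /fg_eval /= /leval /= mulg1.
move=> h1 h2 eq_h.
have h1E (h : {multiplicative free_group I -> H}) : h 1 = 1.
  by apply: (@mulgI _ (h 1)); rewrite -gmulfM !mulg1.
have eq_letter a (ra : reduced [:: a]) : h1 (FreeGroup ra) = h2 (FreeGroup ra).
  have eq_gen i : h1 (fg_gen i) = h2 (fg_gen i) by apply: eq_h; exists i.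
  case: a ra => i [] ra.
    by have -> : FreeGroup ra = fg_gen i by apply: val_inj.
  have -> : FreeGroup ra = (fg_gen i)^-1 by apply: val_inj.
  apply: (@mulgI _ (h1 (fg_gen i))); rewrite -gmulfM mulgV h1E.
  by rewrite eq_gen -gmulfM mulgV h1E.
case; elim=> [|a w IHw] rw.
  have -> : FreeGroup rw = 1 by apply: val_inj.
  by rewrite !h1E.
have rw' : reduced w by exact: path_sorted rw.
have -> : FreeGroup rw = FreeGroup (isT : reduced [:: a]) * FreeGroup rw'.
  apply: val_inj => /=.
  by case: w rw {IHw rw'} => [|b w] //= /andP[/negPf ->].
by rewrite !gmulfM IHw eq_letter.
Qed.

(* Main.v *)
From HB Require Import structures.
Require Import Defs.
From mathcomp Require Import all_boot zify.
From Stdlib Require Import Classical.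

(** The images of the generators are straightened one at a time.  Suppose that
    an automorphism alpha of the free group F has been found such that
    alpha (phi x_i) is a generator for every i in a nonempty list L, and let K
    be the list of these generators.  For a further generator x_i and any w in
    the subgroup generated by the x_l with l in L, the element x_i w is
    primitive, hence so is g h, where g = alpha (phi x_i) and h is an arbitrary
    element of the subgroup <K>.  The heart of the proof is that this forces
    K and g together to be part of a basis (completes_of_all_products):
    another automorphism fixes K and sends g to a generator outside K.  When
    all generators have been treated, alpha o phi permutes them, so phi is
    bijective.

    To see that K and g are part of a basis, use Whitehead graphs.  The Whitehead
    graph of a cyclically reduced word w has the letters as vertices and an edge
    between a^-1 and b for each cyclic subword a b of w.  If w represents a
    primitive element and involves two generators, deleting some vertex
    disconnects the graph (whitehead_cut).  Indeed, write elements in a basis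
    containing w, and colour an element by its first letter in that basis, the
    letters w and w^-1 counting as no colour.  The colour is invariant under
    right multiplication by w, and changes along only finitely many edges of
    the Cayley tree of the original basis; if no vertex cuts the graph, then
    following translates of the axis of w around each vertex of the tree shows
    that the colour is constant outside a ball (far_field), which is absurd.

    Now represent g by a reduced word u whose first and last letters are not in
    K, and apply this to u w, where w is a positive word in K containing all
    products of two generators of K.  The letters of K other than the cut
    vertex t lie on one side, and the letters on the other side define a
    Whitehead automorphism that fixes K.  Comparing the number of turns of u
    that it separates with the number of occurrences of t and its inverse
    (crossings_at), one sees that it shortens u or that the turns inside u do
    not leave one of the sides.  In the latter case another Whitehead
    automorphism shortens u, unless some generator outside K occurs in u exactly
    once (closed_side), and then g visibly completes K.  Hence induction on the
    length of g applies.

    The first generator has no K to work with.  It is handled by adjoining a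
    new letter y to F: if g is primitive in F, then g y^m is primitive in the
    larger group for all m, so the previous argument applies with K = {y}, and
    killing y afterwards gives the automorphism of F that is needed
    (retract_primitive_completes). *)

Set Implicit Arguments.
Unset Strict Implicit.
Unset Printing Implicit Defensive.

Local Open Scope group_scope.

(** * Words and the elements they represent *)

Section Homs.
Variables (G H : groupType) (h : {multiplicative G -> H}).

Lemma hom1 : h 1 = 1.
Proof. by apply: (@mulgI _ (h 1)); rewrite -gmulfM !mulg1. Qed.

Lemma homV x : h x^-1 = (h x)^-1.
Proof. by apply: (@mulgI _ (h x)); rewrite -gmulfM !mulgV hom1. Qed.

End Homs.

(** Locked, so that rewriting does not unfold a product of letters. *)
HB.lock Definition elt (I : choiceType) (s : seq (I * bool)) : free_group I :=
  weval (@fg_gen I) s.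

Section Elements.
Variable I : choiceType.
Local Notation letter := (I * bool)%type.
Implicit Types (s t : seq letter) (a b : letter) (g : free_group I).

Lemma weval_cat (H : groupType) (f : I -> H) s t :
  weval f (s ++ t) = weval f s * weval f t.
Proof. by elim: s => [|a s IHs] /=; rewrite ?mul1g // IHs mulgA. Qed.

Lemma elt_cat s t : elt (s ++ t) = elt s * elt t.
Proof. by rewrite elt.unlock weval_cat. Qed.

Lemma elt_nil : elt [::] = 1 :> free_group I.
Proof. by rewrite elt.unlock. Qed.

Lemma elt_cons a s : elt (a :: s) = elt [:: a] * elt s.
Proof. exact: (elt_cat [:: a]). Qed.

Lemma elt1 (i : I) (e : bool) : elt [:: (i, e)] = if e then fg_gen i else (fg_gen i)^-1.
Proof. by rewrite elt.unlock /= mulg1. Qed.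

Lemma fgword_letter a : fgword (elt [:: a]) = [:: a].
Proof. by case: a => i []; rewrite elt1. Qed.

Lemma fgword_elt_cons a s : fgword (elt (a :: s)) = lact a (fgword (elt s)).
Proof. by rewrite elt_cons -[LHS]/(wmul (elt [:: a]) (elt s)) fgword_letter. Qed.

Lemma fgword_elt s : reduced s -> fgword (elt s) = s.
Proof.
elim: s => [|a s IHs red_as]; first by rewrite elt_nil.
rewrite fgword_elt_cons IHs; last exact: path_sorted red_as.
by case: s red_as {IHs} => //= b s /andP[/negPf->].
Qed.

Lemma reduced_fgword g : reduced (fgword g).
Proof. exact: (valP g). Qed.

Lemma elt_fgword g : elt (fgword g) = g.
Proof. by apply: val_inj; apply: fgword_elt; apply: valP. Qed.

Lemma elt_linv a : elt [:: linv a] = (elt [:: a])^-1.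
Proof. by case: a => i []; rewrite /linv !elt1 ?invgK. Qed.

Lemma winv_cons a s : winv (a :: s) = winv s ++ [:: linv a].
Proof. by rewrite /winv /= rev_cons cats1. Qed.

Lemma elt_winv s : elt (winv s) = (elt s)^-1.
Proof.
elim: s => [|a s IHs]; first by rewrite elt_nil invg1.
by rewrite winv_cons elt_cat IHs elt_linv (elt_cons a s) invgM.
Qed.

Lemma size_lact a s : size (lact a s) <= (size s).+1.
Proof. by case: s => //= b s; case: ifP => //= _; lia. Qed.

Lemma size_elt s : size (fgword (elt s)) <= size s.
Proof.
elim: s => [|a s IHs]; [by rewrite elt_nil | rewrite fgword_elt_cons].
by apply: leq_trans (size_lact _ _) _.
Qed.

Lemma hom_elt (H : groupType) (h : {multiplicative free_group I -> H}) s :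
  h (elt s) = weval (fun i => h (fg_gen i)) s.
Proof.
elim: s => [|[i b] s IHs]; first by rewrite elt_nil hom1.
rewrite elt_cons gmulfM IHs /=; congr (_ * _).
by case: b; rewrite elt1 /leval //= homV.
Qed.

Lemma hom_eq (H : groupType) (h1 h2 : {multiplicative free_group I -> H}) :
  (forall i, h1 (fg_gen i) = h2 (fg_gen i)) -> h1 =1 h2.
Proof.
move=> eq_h g; rewrite -(elt_fgword g) !hom_elt.
by elim: (fgword g) => //= a s ->; rewrite /leval eq_h.
Qed.

Lemma fg_eval_gen (H : groupType) (f : I -> H) i : fg_eval f (fg_gen i) = f i.
Proof. by rewrite /fg_eval /= mulg1. Qed.

Definition word_over (G : pred I) s := all (fun a => G a.1) s.

Lemma word_over_cat G s t : word_over G (s ++ t) = word_over G s && word_over G t.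
Proof. exact: all_cat. Qed.

Lemma word_over_rcons G s a : word_over G (rcons s a) = G a.1 && word_over G s.
Proof. exact: all_rcons. Qed.

Lemma word_over_winv G s : word_over G (winv s) = word_over G s.
Proof. by rewrite /word_over /winv all_rev all_map; apply: eq_all. Qed.

Lemma word_over_elt G s : word_over G s -> word_over G (fgword (elt s)).
Proof.
elim: s => [|a s IHs]; first by rewrite elt_nil.
case/andP=> Ga /IHs; rewrite fgword_elt_cons.
case: (fgword _) => [|b t] /= => [_|/andP[Gb Gt]]; first by rewrite Ga.
by case: ifP => _ //=; rewrite Ga Gb.
Qed.

Lemma reduced_cat s t : reduced (s ++ t) -> reduced s /\ reduced t.
Proof. by rewrite /reduced => /cat_sorted2[]. Qed.

Lemma reduced_cat_cons s a b t :
  reduced (rcons s a ++ b :: t) = [&& reduced (rcons s a), b != linv a & reduced (b :: t)].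
Proof.
rewrite /reduced cat_rcons sorted_cat_cons -[path _ a _]/((b != linv a) && path _ b t).
by rewrite andbA.
Qed.

Lemma linv_neq a : linv a != a.
Proof. by case: a => i b; rewrite /linv xpair_eqE eqxx /=; case: b. Qed.

End Elements.

(** * Functions on the Cayley tree that are invariant along an axis *)

Section Powers.
Variable I : choiceType.
Local Notation letter := (I * bool)%type.
Implicit Types (s t r w p q : seq letter) (a b : letter).

Lemma reduced_glue s t r :
  t <> [::] -> reduced (s ++ t) -> reduced (t ++ r) -> reduced (s ++ t ++ r).
Proof.
case: t => // b t _; rewrite /reduced /= !sorted_cat_cons.
by move=> /andP[-> _] ->.
Qed.

Definition wpow w k := flatten (nseq k w).

Lemma wpowS w k : wpow w k.+1 = w ++ wpow w k.
Proof. by []. Qed.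

Lemma wpowSr w k : wpow w k.+1 = wpow w k ++ w.
Proof. by elim: k => [|k IHk]; [exact: cats0 | rewrite wpowS {1}IHk catA]. Qed.

Lemma size_wpow w k : size (wpow w k) = (k * size w)%N.
Proof. by elim: k => // k IHk; rewrite wpowS size_cat IHk mulSn. Qed.

Lemma elt_wpow w k : elt (wpow w k) = elt w ^+ k.
Proof. by elim: k => [|k IHk]; rewrite ?elt_nil // wpowS elt_cat IHk expgS. Qed.

Lemma word_over_wpow G w k : word_over G w -> word_over G (wpow w k).
Proof. by move=> Gw; elim: k => // k IHk; rewrite wpowS word_over_cat Gw. Qed.

Lemma reduced_wpow w k : w <> [::] -> reduced (w ++ w) -> reduced (wpow w k).
Proof.
move=> w0 rww; have [rw _] := reduced_cat rww.
elim: k => [|[|k] IHk] //; first by rewrite wpowS cats0.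
by rewrite !wpowS; apply: reduced_glue.
Qed.

Lemma winv_cat s t : winv (s ++ t) = winv t ++ winv s.
Proof. by rewrite /winv map_cat rev_cat. Qed.

Lemma size_winv s : size (winv s) = size s.
Proof. by rewrite /winv size_rev size_map. Qed.

End Powers.

Section FarField.
Variables (I : choiceType) (G : pred I) (w : seq (I * bool)).
Variables (C : eqType) (c : free_group I -> C) (N : nat).
Local Notation letter := (I * bool)%type.
Implicit Types (s r p q : seq letter) (a b : letter).

Definition cyclic_turn w (a b : I * bool) := infix [:: a; b] (w ++ w).

(** The Whitehead graph of the cyclic word w, on the letters over G, stays
    connected when any one vertex is deleted.  Connectedness is phrased as: a
    function that is constant along the edges is constant. *)
Definition no_cut :=
  forall t : letter, G t.1 -> forall P : pred letter,
  (forall a b, cyclic_turn w a b -> linv a != t -> b != t -> P (linv a) = P b) ->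
  forall x y, G x.1 -> G y.1 -> x != t -> y != t -> P x = P y.

Hypotheses (Gw : word_over G w) (w0 : w <> [::]) (rww : reduced (w ++ w)).
Hypothesis c_inv : forall g, c (g * elt w) = c g.
Hypothesis c_far : forall p a, reduced (rcons p a) -> word_over G (rcons p a) ->
  N <= size p -> c (elt (rcons p a)) = c (elt p).
Variables (i0 j0 : I).
Hypotheses (Gi0 : G i0) (Gj0 : G j0) (i0j0 : i0 != j0).
Hypothesis nocut : no_cut.

Let c_invX k g : c (g * elt w ^+ k) = c g.
Proof. by elim: k => [|k IHk]; rewrite ?mulg1 // expgSr mulgA c_inv. Qed.

Let c_invXV k g : c (g * (elt w ^+ k)^-1) = c g.
Proof. by rewrite -(c_invX k (g * _)) mulgVK. Qed.

Let far_cyl p q : reduced (p ++ q) -> word_over G (p ++ q) -> N <= size p ->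
  c (elt (p ++ q)) = c (elt p).
Proof.
elim/last_ind: q => [|q a IHq]; first by rewrite cats0.
rewrite -rcons_cat => rpqa Opqa le_p; rewrite c_far ?size_cat //;
  last by rewrite (leq_trans le_p) ?leq_addr.
apply: IHq => //.
  by move: rpqa; rewrite -cats1 => /reduced_cat[].
by move: Opqa; rewrite word_over_rcons => /andP[].
Qed.

Let size_w : 0 < size w.
Proof. by case: w w0. Qed.

Definition constant_beyond p := forall q q',
  reduced (p ++ q) -> word_over G (p ++ q) -> N <= size (p ++ q) ->
  reduced (p ++ q') -> word_over G (p ++ q') -> N <= size (p ++ q') ->
  c (elt (p ++ q)) = c (elt (p ++ q')).

(** Seen from the vertex p of the Cayley tree, the translate of the axis of w
    that passes through p along the turn a b leaves in the directions b and
    linv a.  Since c is invariant under w, it takes the same value far out at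
    both ends. *)
Let far_turn p a b : reduced p -> word_over G p ->
  cyclic_turn w a b ->
  (p = [::] \/ exists p' z, [/\ p = rcons p' z, linv a != linv z & b != linv z]) ->
  exists q q',
   [/\ reduced (p ++ b :: q), word_over G (p ++ b :: q) & N <= size (p ++ b :: q)] /\
   [/\ reduced (p ++ linv a :: q'), word_over G (p ++ linv a :: q'), N <= size (p ++ linv a :: q') &
   c (elt (p ++ b :: q)) = c (elt (p ++ linv a :: q'))].
Proof.
move=> rp Op /infixP[s [r eww]] pab.
have red2 : forall k, reduced (wpow w k) by move=> k; apply: reduced_wpow.
have ext x q : G x.1 -> word_over G q -> reduced (x :: q) ->
   (p = [::] \/ exists p' z, p = rcons p' z /\ x != linv z) ->
   reduced (p ++ x :: q) /\ word_over G (p ++ x :: q).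
  move=> Gx Oq rxq px; split; last by rewrite word_over_cat /= Gx; apply/andP.
  case: px => [->//|[p' [z [ep xz]]]].
  by rewrite ep reduced_cat_cons -ep rp xz.
pose X := r ++ wpow w N.
pose Y := winv (wpow w N ++ s).
have eX : s ++ a :: b :: X = wpow w N.+2.
  by rewrite !wpowS /X catA eww /= -!catA.
have eY : winv Y ++ a :: b :: r = wpow w N.+2.
  by rewrite /Y winvK 2!wpowSr -!catA eww -?catA.
have rX : reduced (b :: X).
  by have := red2 N.+2; rewrite -eX -cat_rcons => /reduced_cat[].
have rY : reduced (linv a :: Y).
  have := red2 N.+2; rewrite -eY -cat_rcons => /reduced_cat[/reduced_winv + _].
  by rewrite -cats1 winv_cat winvK.
have OX : word_over G (s ++ a :: b :: X) by rewrite eX; apply: word_over_wpow.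
have OY : word_over G (winv Y ++ a :: b :: r) by rewrite eY; apply: word_over_wpow.
have [Ga Gb {}OX] : [/\ G a.1, G b.1 & word_over G X].
  by move: OX; rewrite word_over_cat /= => /and4P[].
have {}OY : word_over G Y by move: OY; rewrite word_over_cat word_over_winv => /andP[].
(* With w w = s a b r, the translate g = p (s a)^-1 makes g w^(N+2) = p b X
   and g w^-N = p a^-1 Y reduced words. *)
exists X, Y.
have [|rpX OpX] := ext b X Gb OX rX.
  by case: pab => [|[p' [z [-> _ bz]]]]; [left | right; exists p', z].
have [|rpY OpY] := ext (linv a) Y Ga OY rY.
  by case: pab => [|[p' [z [-> az _]]]]; [left | right; exists p', z].
have leN : (N <= N * size w)%N by rewrite leq_pmulr.
split; split=> //.
- by rewrite size_cat /= /X size_cat size_wpow; move: leN; clear; lia.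
- by rewrite size_cat /= /Y size_winv size_cat size_wpow; move: leN; clear; lia.
pose g := elt p * (elt (s ++ [:: a]))^-1.
have -> : elt (p ++ b :: X) = g * elt w ^+ N.+2.
  have eX' : (s ++ [:: a]) ++ b :: X = wpow w N.+2 by rewrite -catA.
  by rewrite elt_cat /g -elt_wpow -eX' (elt_cat (s ++ [:: a])) -mulgA mulKg.
have -> : elt (p ++ linv a :: Y) = g * (elt w ^+ N)^-1.
  rewrite elt_cat (elt_cons (linv a)) elt_linv /Y elt_winv -elt_wpow /g -!mulgA.
  by rewrite !elt_cat !invgM !mulgA.
by rewrite c_invX c_invXV.
Qed.

(** At the root of the tree no vertex has to be deleted, but no_cut speaks of
    graphs with a vertex deleted: a third letter serves. *)
Let third (x y : letter) : exists t : letter, [/\ G t.1, x != t & y != t].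
Proof.
pose l := [:: (i0, true); (i0, false); (j0, true)].
have [/hasP[z tl /andP[xt yt]]|noth] := boolP (has (fun z => (x != z) && (y != z)) l).
  by exists z; split=> //; move: tl; rewrite !inE => /or3P[] /eqP->.
have : size l <= size [:: x; y].
  apply: uniq_leq_size => [|z /(hasPn noth)].
    by rewrite /= !inE !xpair_eqE eqxx (negPf i0j0).
  by rewrite negb_and !negbK !inE ![z == _]eq_sym.
by [].
Qed.

Lemma nseq_far p x : reduced p -> word_over G p -> G x.1 ->
   (p = [::] \/ exists p' z, p = rcons p' z /\ x != linv z) ->
   reduced (p ++ x :: nseq N x) /\ word_over G (p ++ x :: nseq N x).
Proof.
move=> rp Op Gx px; have On : word_over G (x :: nseq N x).
  by rewrite /word_over -[x :: _]/(nseq N.+1 x) all_nseq Gx orbT.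
split; last by rewrite word_over_cat; apply/andP.
have rn : reduced (x :: nseq N x).
  elim: (N) => //= k ->; by rewrite eq_sym linv_neq.
case: px => [->//|[p' [z [ep xz]]]].
by rewrite ep reduced_cat_cons -ep rp xz.
Qed.

(** Inductive step towards the root.  Beyond p, the far value of c depends
    only on the direction in which p is left; it agrees for two directions
    joined by an edge of the Whitehead graph, and the direction t leading back
    to the root is the deleted vertex. *)
Lemma far_step p : reduced p -> word_over G p ->
  (forall x, reduced (rcons p x) -> word_over G (rcons p x) -> constant_beyond (rcons p x)) ->
  size p < N -> constant_beyond p.
Proof.
move=> rp Op IH lt_p q q'; have le_p : ~ N <= size p by apply/negP; rewrite -ltnNge.
case: q => [|x q] rpx Opx lpx; first by case: le_p; rewrite cats0 in lpx.
case: q' => [|y q'] rpy Opy lpy; first by case: le_p; rewrite cats0 in lpy.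
have Gx : G x.1 by move: Opx; rewrite word_over_cat /= => /and3P[].
have Gy : G y.1 by move: Opy; rewrite word_over_cat /= => /and3P[].
have [t [Gt xt yt ht]] : exists t,
    [/\ G t.1, x != t, y != t & p = [::] \/ exists p' z, p = rcons p' z /\ linv z = t].
  case: (lastP p) rpx rpy Op => [|p' z].
    by have [t [Gt xt yt]] := third x y; exists t; split=> //; left.
  rewrite !reduced_cat_cons => /and3P[_ xz _] /and3P[_ yz _] Op.
  exists (linv z); split=> //; last by right; exists p', z.
  by move: Op; rewrite word_over_rcons => /andP[].
have adm z : z != t -> p = [::] \/ exists p' z', p = rcons p' z' /\ z != linv z'.
  by move=> zt; case: ht => [|[p' [z' [ep et]]]]; [left | right; exists p', z'; rewrite et].
have cyl z q1 q2 :
  reduced (p ++ z :: q1) -> word_over G (p ++ z :: q1) -> N <= size (p ++ z :: q1) ->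
  reduced (p ++ z :: q2) -> word_over G (p ++ z :: q2) -> N <= size (p ++ z :: q2) ->
  c (elt (p ++ z :: q1)) = c (elt (p ++ z :: q2)).
  rewrite -!cat_rcons => r1 O1 s1 r2 O2 s2; apply: IH => //.
    by have [] := reduced_cat r1.
  by move: O1; rewrite word_over_cat => /andP[].
pose v z := c (elt (p ++ z :: nseq N z)).
have vE z q1 : z != t -> G z.1 ->
  reduced (p ++ z :: q1) -> word_over G (p ++ z :: q1) -> N <= size (p ++ z :: q1) ->
  c (elt (p ++ z :: q1)) = v z.
  move=> zt Gz r1 O1 s1; have [r2 O2] := nseq_far rp Op Gz (adm z zt).
  by apply: cyl => //; rewrite size_cat /= size_nseq addnS leqW ?leq_addl.
rewrite !vE //; apply/eqP.
(* no_cut is applied to the set of directions with the far value of y. *)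
rewrite -[_ == _]/([pred z | v z == v y] x) (nocut Gt _ Gx Gy) //=.
move=> a b tab at_ bt /=.
have [|q1 [q2 [[r1 O1 s1] [r2 O2 s2 e]]]] := far_turn rp Op tab.
  by case: ht => [|[p' [z' [ep et]]]]; [left | right; exists p', z'; rewrite et].
have Gb : G b.1 by move: O1; rewrite word_over_cat /= => /and3P[].
have Ga : G (linv a).1 by move: O2; rewrite word_over_cat /= => /and3P[].
by rewrite -(vE _ _ bt Gb r1 O1 s1) -(vE _ _ at_ Ga r2 O2 s2) e.
Qed.

Lemma far_field q q' :
  reduced q -> word_over G q -> N <= size q -> reduced q' -> word_over G q' -> N <= size q' ->
  c (elt q) = c (elt q').
Proof.
have main m : forall p, N <= size p + m -> reduced p -> word_over G p -> constant_beyond p.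
  elim: m => [|m IHm] p.
    rewrite addn0 => le_p rp Op q1 q2 r1 O1 s1 r2 O2 s2.
    by rewrite !far_cyl.
  move=> le_p rp Op; case: (leqP N (size p)) => [le_p'|lt_p].
    by apply: IHm => //; rewrite (leq_trans le_p') ?leq_addr.
  by apply: far_step => // x rx Ox; apply: IHm => //; rewrite size_rcons addSnnS.
exact: (main N [::]).
Qed.

End FarField.

(** * Primitive elements and the Whitehead graph *)

(** This holds for primitive elements, and keeps from primitivity only what
    gives normal forms: the group is a retract of a free group in which v
    becomes a letter.  Unlike membership in a basis, it passes easily to a
    larger free group. *)
Definition retract_primitive (I : choiceType) (v : free_group I) : Prop :=
  exists (J : choiceType) (theta : {multiplicative free_group I -> free_group J})
    (eta : {multiplicative free_group J -> free_group I}) (j : J),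
    cancel theta eta /\ theta v = fg_gen j.

Section Words.
Variable I : choiceType.
Local Notation letter := (I * bool)%type.
Implicit Types (s : seq letter) (a b : letter) (g h : free_group I).

Lemma size_mul g h : (size (fgword (g * h)%g) <= size (fgword g) + size (fgword h))%N.
Proof. by rewrite -{1}(elt_fgword g) -{1}(elt_fgword h) -elt_cat -size_cat size_elt. Qed.

Lemma word_over_mul G g h : word_over G (fgword g) -> word_over G (fgword h) ->
  word_over G (fgword (g * h)).
Proof.
move=> Gg Gh; rewrite -(elt_fgword g) -(elt_fgword h) -elt_cat.
by apply: word_over_elt; rewrite word_over_cat Gg.
Qed.

Lemma fgword_mul_letter g a :
  fgword (g * elt [:: a]) = rcons (fgword g) a \/
  fgword g = rcons (fgword (g * elt [:: a])) (linv a).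
Proof.
case: (lastP (fgword g)) (elt_fgword g) (reduced_fgword g) => [|s b] <- red_s.
  by left; rewrite elt_nil mul1g fgword_letter.
rewrite -elt_cat; case: (eqVneq b (linv a)) => [eb|nb].
  right; rewrite -cats1 -catA eb elt_cat (elt_cons (linv a)) elt_linv mulVg mulg1 cats1.
  by rewrite fgword_elt //; move: red_s; rewrite -cats1 => /reduced_cat[].
left; rewrite cats1 fgword_elt // -cats1 reduced_cat_cons red_s /= andbT.
by rewrite -(inj_eq (inv_inj (@linvK I))) linvK eq_sym.
Qed.

Lemma commute_word_over j s g : word_over (pred1 j) s -> commute g (fg_gen j) ->
  commute g (elt s).
Proof.
move=> + com; elim: s => [|[i b] s IHs] /=; first by rewrite elt_nil => _; apply: commute1.
rewrite /= => /andP[/eqP-> /IHs com_s]; rewrite elt_cons; apply: commuteM => //.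
by rewrite elt1; case: b => //; apply: commuteV.
Qed.

End Words.

Section FirstLetter.
Variables (J : choiceType) (j : J).
Implicit Types (g h : free_group J).

(** The first letter, where an empty word and a word starting with j or its
    inverse are not distinguished: this makes it invariant under right
    multiplication by j. *)
Definition first_other (s : seq (J * bool)) :=
  if s is a :: _ then (if a.1 == j then None else Some a) else None.

Lemma first_other_rcons s a : s <> [::] \/ a.1 = j -> first_other (rcons s a) = first_other s.
Proof. by case: s => [|b s] //= [//|->]; rewrite eqxx. Qed.

Lemma first_other_mul_gen g : first_other (fgword (g * fg_gen j)) = first_other (fgword g).
Proof.
have <- : elt [:: (j, true)] = fg_gen j by rewrite elt1.
by case: (fgword_mul_letter g (j, true)) => ->; rewrite first_other_rcons //; right.
Qed.

(** Multiplication on the right by h affects the first letter of g only if it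
    cancels the whole of g, that is, if g is inverse to a prefix of h. *)
Lemma first_other_mul h : exists L : seq (free_group J), forall g, g \notin L ->
  first_other (fgword (g * h)) = first_other (fgword g).
Proof.
rewrite -(elt_fgword h); elim: (fgword h) => [|a s [L HL]].
  by exists [::] => g _; rewrite elt_nil mulg1.
exists [:: 1, elt [:: linv a] & [seq x * elt [:: linv a] | x <- L]] => g.
rewrite !inE !negb_or => /and3P[g1 ga gL].
rewrite elt_cons mulgA HL; last first.
  apply: contra gL => gL; apply/mapP; exists (g * elt [:: a]) => //.
  by rewrite elt_linv mulgK.
have nil_eq1 (x : free_group J) : fgword x = [::] -> x = 1.
  by move=> ex; rewrite -(elt_fgword x) ex elt_nil.
case: (fgword_mul_letter g a) => [->|eg].
  by rewrite first_other_rcons //; left => /nil_eq1 e; rewrite e eqxx in g1.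
rewrite eg first_other_rcons //; left => e.
by move: ga; rewrite -(elt_fgword g) eg e eqxx.
Qed.

End FirstLetter.

(** Whitehead's cut vertex lemma.  If no vertex cuts, far_field makes the first
    letter c constant far out in the subgroup generated by G, hence equal to
    None there, as on the powers of w; by invariance under w it is None on the
    whole subgroup.  Peeling off first letters, theta maps this subgroup into
    the powers of j, although it contains two generators that do not commute. *)
Lemma whitehead_cut (I : choiceType) (G : seq I) (w : seq (I * bool)) (i0 j0 : I) :
  word_over (mem G) w -> w <> [::] -> reduced (w ++ w) ->
  i0 \in G -> j0 \in G -> i0 != j0 -> retract_primitive (elt w) -> ~ no_cut (mem G) w.
Proof.
move=> Gw w0 rww Gi0 Gj0 i0j0 [J [theta [eta [j [thK th_w]]]]] nocut.
pose c g := first_other j (fgword (theta g)).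
have c_inv g : c (g * elt w) = c g by rewrite /c gmulfM th_w first_other_mul_gen.
have far a : exists N, forall p, N <= size p -> reduced (rcons p a) ->
    c (elt (rcons p a)) = c (elt p).
  have [L HL] := first_other_mul j (theta (elt [:: a])).
  exists (\max_(x <- L) size (fgword (eta x))).+1 => p le_p rpa.
  rewrite -cats1 elt_cat /c gmulfM HL //; apply/negP => inL.
  have := @leq_bigmax_seq _ L xpredT (fun x => size (fgword (eta x))) _ inL isT.
  rewrite thK fgword_elt; last by move: rpa; rewrite -cats1 => /reduced_cat[].
  by rewrite leqNgt le_p.
have [N far_N] : exists N, forall p a, reduced (rcons p a) -> word_over (mem G) (rcons p a) ->
    N <= size p -> c (elt (rcons p a)) = c (elt p).
  have [N HN] : exists N, forall a, a.1 \in G -> forall p, N <= size p -> reduced (rcons p a) ->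
      c (elt (rcons p a)) = c (elt p).
    elim: (G) => [|i G' [N HN]]; first by exists 0.
    have [N1 H1] := far (i, true); have [N2 H2] := far (i, false).
    exists (maxn N (maxn N1 N2)) => -[i' b].
    rewrite inE /= => /orP[/eqP->|Gi] p; rewrite !geq_max => /and3P[? ? ?].
      by case: b; [apply: H1 | apply: H2].
    exact: HN.
  by exists N => p a rpa; rewrite word_over_rcons => /andP[Ga _] le_p; apply: HN.
have const := far_field Gw w0 rww c_inv far_N Gi0 Gj0 i0j0 nocut.
have c_invX k g : c (g * elt w ^+ k) = c g.
  by elim: k => [|k IHk]; rewrite ?mulg1 // expgSr mulgA c_inv.
have size_wX k : size (fgword (elt w ^+ k)) = (k * size w)%N.
  by rewrite -elt_wpow fgword_elt ?size_wpow //; apply: reduced_wpow.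
have over_wX k : word_over (mem G) (fgword (elt w ^+ k)).
  by rewrite -elt_wpow; apply/word_over_elt/word_over_wpow.
have size_w : 0 < size w by case: (w) w0.
have cN g : word_over (mem G) (fgword g) -> c g = None.
  move=> Gg; pose k := (N + size (fgword g))%N.
  have <- : c 1 = None by rewrite /c hom1.
  rewrite -(c_invX k g) -(c_invX k 1) mul1g.
  have := const (fgword (g * elt w ^+ k)) (fgword (elt w ^+ k)).
  rewrite !elt_fgword; apply; rewrite ?reduced_fgword ?over_wX //.
  - exact: word_over_mul.
  - have := size_mul g^-1 (g * elt w ^+ k); rewrite mulKg size_wX.
    rewrite -[fgword g^-1]/(winv (fgword g)) size_winv.
    have : (k <= k * size w)%N by rewrite leq_pmulr.
    rewrite /k; clear; lia.
  - by rewrite size_wX; apply: leq_trans (leq_pmulr _ size_w); rewrite /k leq_addr.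
have th_over g : word_over (mem G) (fgword g) -> word_over (pred1 j) (fgword (theta g)).
  have [n] := ubnP (size (fgword (theta g))); elim: n g => // n IHn g lt_n Gg.
  have := cN g Gg; rewrite /c; case E: (fgword (theta g)) lt_n => [|[i b] s] //=.
  case: eqP E => // -> E lt_n _.
  pose g' := elt (if b then winv w else w) * g.
  have e' : theta g' = elt s.
    rewrite gmulfM -(elt_fgword (theta g)) E (elt_cons (j, b)) elt1.
    rewrite /g'; case: (b); first by rewrite elt_winv homV th_w mulKg.
    by rewrite th_w mulVKg.
  have rs : reduced s by have := reduced_fgword (theta g); rewrite E => /path_sorted.
  have := IHn g'; rewrite e' fgword_elt //; apply; first by rewrite -ltnS.
  apply: word_over_mul => //; apply: word_over_elt.
  by case: (b); rewrite ?word_over_winv.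
have com : theta (fg_gen i0) * theta (fg_gen j0) = theta (fg_gen j0) * theta (fg_gen i0).
  have comj g : word_over (mem G) (fgword g) -> commute (fg_gen j) (theta g).
    by move=> /th_over o; rewrite -(elt_fgword (theta g));
       apply: commute_word_over o (commute_refl _).
  rewrite -(elt_fgword (theta (fg_gen j0))); apply: (commute_word_over (j := j)).
    by apply: th_over; rewrite /= Gj0.
  by apply/commute_sym/comj; rewrite /= Gi0.
move: com; rewrite -!gmulfM => /(can_inj thK)/(congr1 (@fgword I)).
have e2 i i' : fg_gen i * fg_gen i' = elt [:: (i, true); (i', true)].
  by rewrite elt_cons !elt1.
rewrite !e2 !fgword_elt /reduced /= ?andbT /linv /= ?xpair_eqE ?andbF //.
by case=> e; rewrite e eqxx in i0j0.
Qed.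

(** * Automorphisms and their effect on length *)

Section Automorphisms.
Variable I : choiceType.
Local Notation letter := (I * bool)%type.
Local Notation F := (free_group I).
Implicit Types (s u v : seq letter) (a b x y z : letter) (g : F) (K : seq I).

Lemma cancel_gen (J : choiceType) (al : {multiplicative F -> free_group J})
    (be : {multiplicative free_group J -> F}) :
  (forall i, be (al (fg_gen i)) = fg_gen i) -> cancel al be.
Proof.
move=> albe g; rewrite -(elt_fgword g); elim: (fgword g) => [|[i b] s IHs].
  by rewrite elt_nil !hom1.
rewrite elt_cons !gmulfM IHs; congr (_ * _); rewrite elt1.
by case: b; rewrite ?homV albe.
Qed.

Lemma hom_fix (al : {multiplicative F -> F}) (G : pred I) s :
  (forall i, G i -> al (fg_gen i) = fg_gen i) -> word_over G s -> al (elt s) = elt s.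
Proof.
move=> fix_al; elim: s => [|[i b] s IHs]; first by rewrite elt_nil hom1.
move=> /= /andP[Gi /IHs IH]; rewrite elt_cons gmulfM IH; congr (_ * _); rewrite elt1.
by case: b; rewrite ?homV fix_al.
Qed.

Definition aut_fixing K (al be : {multiplicative F -> F}) :=
  [/\ cancel al be, cancel be al & forall i, i \in K -> al (fg_gen i) = fg_gen i].

(** K and g are together part of a basis. *)
Definition completes K g :=
  exists al be j, [/\ aut_fixing K al be, j \notin K & al g = fg_gen j].

Lemma completes_aut K al be g : aut_fixing K al be -> completes K (al g) -> completes K g.
Proof.
move=> [ab ba fa] [al' [be' [j [[ab' ba' fa'] jK e]]]].
exists (al' \o al), (be \o be'), j; split=> //; split.
- exact: can_comp.
- exact: can_comp.
- by move=> i iK; rewrite /= fa // fa'.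
Qed.

(** A generator outside K that occurs only once in a word can be exchanged for
    that word. *)
Lemma completes_solo K s x s' : x.1 \notin K ->
  word_over (predC1 x.1) s -> word_over (predC1 x.1) s' ->
  completes K (elt s * elt [:: x] * elt s').
Proof.
case: x => j b /= jK js js'.
pose A := if b then (elt s)^-1 * fg_gen j * (elt s')^-1 else elt s' * (fg_gen j)^-1 * elt s.
pose B := elt s * elt [:: (j, b)] * elt s'.
pose al : {multiplicative F -> F} := fg_eval (fun i => if i == j then A else fg_gen i).
pose be : {multiplicative F -> F} := fg_eval (fun i => if i == j then B else fg_gen i).
have alj : al (fg_gen j) = A by rewrite /al /= fg_eval_gen eqxx.
have bej : be (fg_gen j) = B by rewrite /be /= fg_eval_gen eqxx.
have alN i : predC1 j i -> al (fg_gen i) = fg_gen i.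
  by rewrite /al /= fg_eval_gen => /negPf->.
have beN i : predC1 j i -> be (fg_gen i) = fg_gen i.
  by rewrite /be /= fg_eval_gen => /negPf->.
have alB : al B = fg_gen j.
  rewrite !gmulfM (hom_fix alN js) (hom_fix alN js') elt1.
  case: (b) @A @al alj {alN} => A al alj.
    by rewrite alj /A !mulgA mulgV mul1g mulgVK.
  by rewrite homV alj /A !invgM invgK !mulgA mulgV mul1g mulgVK.
have beA : be A = fg_gen j.
  case: (b) @A @B @be bej beN {al alj alN alB} => A B be bej beN.
    rewrite !gmulfM !homV (hom_fix beN js) (hom_fix beN js') bej /B elt1.
    by rewrite -!mulgA mulKg mulgV mulg1.
  rewrite !gmulfM !homV (hom_fix beN js) (hom_fix beN js') bej /B elt1 !invgM invgK.
  by rewrite !mulgA mulgV mul1g mulgVK.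
exists al, be, j; split=> //; split.
- apply: cancel_gen => i; case: (eqVneq i j) => [->|ij]; first by rewrite alj beA.
  by rewrite alN // beN.
- apply: cancel_gen => i; case: (eqVneq i j) => [->|ij]; first by rewrite bej alB.
  by rewrite beN // alN.
- by move=> i iK; apply: alN; apply: contraNneq jK => <-.
Qed.

Lemma completes_mul K h g h' : word_over (mem K) h -> word_over (mem K) h' ->
  completes K g -> completes K (elt h * g * elt h').
Proof.
move=> Kh Kh' [al [be [j [fab jK e]]]]; apply: (completes_aut fab).
have [_ _ fa] := fab; rewrite !gmulfM e (hom_fix fa Kh) (hom_fix fa Kh').
have -> : fg_gen j = elt [:: (j, true)] by rewrite elt1.
have sub s : word_over (mem K) s -> word_over (predC1 j) s.
  by apply: sub_all => a /=; apply: contraTneq => ->.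
by apply: completes_solo => //=; apply: sub.
Qed.

Definition gpow g (b : bool) := if b then g else 1.

(** The Whitehead automorphism with multiplier g: the sides of a letter x that
    D contains are multiplied by g, namely x becomes g x if D contains x, and
    x g^-1 if D contains the inverse of x. *)
Definition whitehead g (D : pred letter) : {multiplicative F -> F} :=
  fg_eval (fun i => gpow g (D (i, true)) * fg_gen i * (gpow g (D (i, false)))^-1).

Lemma whitehead_letter g D x :
  whitehead g D (elt [:: x]) = gpow g (D x) * elt [:: x] * (gpow g (D (linv x)))^-1.
Proof.
case: x => i [] /=; rewrite elt1 ?homV /whitehead /= fg_eval_gen //.
by rewrite /linv /= !invgM invgK mulgA.
Qed.

Lemma whitehead_gpow g D h : whitehead g D h = h ->
  forall e, whitehead g D (gpow h e) = gpow h e.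
Proof. by move=> eh [] //=; rewrite hom1. Qed.

Lemma whitehead_pivot g D a : D a = false -> D (linv a) = false ->
  whitehead g D (elt [:: a]) = elt [:: a].
Proof. by move=> Da Dl; rewrite whitehead_letter Da Dl /= invg1 mulg1 mul1g. Qed.

Lemma gpowV g e : gpow g^-1 e = (gpow g e)^-1.
Proof. by case: e; rewrite //= invg1. Qed.

Lemma whiteheadK a D : D a = false -> D (linv a) = false ->
  cancel (whitehead (elt [:: a]) D) (whitehead (elt [:: a])^-1 D).
Proof.
move=> Da Dl; apply: cancel_gen => i.
have -> : fg_gen i = elt [:: (i, true)] by rewrite elt1.
have e := whitehead_pivot (elt [:: a])^-1 Da Dl.
rewrite whitehead_letter !gmulfM homV !(whitehead_gpow e).
by rewrite whitehead_letter !gpowV !mulgA mulgV mul1g mulgVK.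
Qed.

Lemma whitehead_aut_fixing K a D : D a = false -> D (linv a) = false ->
  (forall x, x.1 \in K -> D x = false) ->
  aut_fixing K (whitehead (elt [:: a]) D) (whitehead (elt [:: a])^-1 D).
Proof.
move=> Da Dl DK; split; first exact: whiteheadK.
  by have := whiteheadK Dl; rewrite linvK elt_linv invgK; apply.
move=> i iK; have -> : fg_gen i = elt [:: (i, true)] by rewrite elt1.
by rewrite whitehead_pivot ?DK.
Qed.

Lemma eq_or_linv x y : x.1 = y.1 -> x = y \/ x = linv y.
Proof.
case: x y => i b [j c] /= ->; case: b; case: c; by [left | right].
Qed.

(** The edges of the Whitehead graph that come from the inside of x :: u. *)
Definition turns x u := pairmap (fun y z => (linv y, z)) x u.
Definition occ (i : I) s := count (fun z => z.1 == i) s.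
Definition crossings (D : pred letter) x u := count (fun yz => D yz.1 != D yz.2) (turns x u).

(** The letter a contributes nothing of its own to an image under the Whitehead
    automorphism: if D contains a but not linv a, then a is entirely accounted
    for by the multiplier that D places in front of it. *)
Definition virtual_letter a x := if x.1 == a.1 then [::] else [:: x].

(** Between two consecutive letters the multipliers cancel unless D separates
    the turn; so the image loses the occurrences of a and gains one letter per
    separated turn. *)
Lemma whitehead_word (D : pred letter) a x u : D a -> ~~ D (linv a) ->
  exists v, whitehead (elt [:: a]) (fun z => D z && (z != a)) (elt (x :: u)) =
    gpow (elt [:: a]) (D x) * elt v * (gpow (elt [:: a]) (D (linv (last x u))))^-1
  /\ (size v + occ a.1 (x :: u) = size (x :: u) + crossings D x u)%N.
Proof.
move=> Da Dl; set A := elt [:: a]; set tau := whitehead _ _.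
have one y : tau (elt [:: y]) = gpow A (D y) * elt (virtual_letter a y) * (gpow A (D (linv y)))^-1.
  rewrite /tau whitehead_letter /virtual_letter; case: (y.1 =P a.1) => [ey|ney].
    have [->|->] : y = a \/ y = linv a.
      exact: eq_or_linv.
    - by rewrite Da (negPf Dl) eqxx /= elt_nil invg1 !mulg1 mul1g.
    - by rewrite linvK Da (negPf Dl) eqxx elt_nil elt_linv /= invg1 !mulg1 mul1g.
  have [-> ->] : (y != a) = true /\ (linv y != a) = true.
  by split; apply/eqP => e; apply: ney; rewrite -e.
  by rewrite !andbT.
have size_one : forall z, (size (virtual_letter a z) + (z.1 == a.1) = 1)%N.
  by move=> z; rewrite /virtual_letter; case: (z.1 == a.1).
elim: u x => [|y u IHu] x.
  exists (virtual_letter a x); split; first exact: one.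
  by rewrite /occ /crossings /= !addn0 size_one.
have [v [ev sv]] := IHu y.
pose mid := if D y then (if D (linv x) then [::] else [:: a])
  else (if D (linv x) then [:: linv a] else [::]).
exists (virtual_letter a x ++ mid ++ v); split.
  rewrite (elt_cons x) gmulfM one ev !elt_cat !mulgA; congr (_ * _ * _).
  rewrite -!mulgA; congr (_ * (_ * _)).
  by rewrite /mid; case: (D y); case: (D _);
    rewrite /= ?elt_nil ?elt_linv ?invg1 ?mulVg ?mulg1 ?mul1g.
have -> : crossings D x (y :: u) = ((D (linv x) != D y) + crossings D y u)%N by [].
have -> : occ a.1 [:: x, y & u] = ((x.1 == a.1) + occ a.1 (y :: u))%N by [].
have smid : size mid = (D (linv x) != D y) by rewrite /mid; case: (D y); case: (D _).
rewrite !size_cat smid; move: sv (size_one x).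
rewrite [size [:: x, y & u]]/=; rewrite -[size (y :: u)]/(size u).+1; clear; lia.
Qed.

(** The multipliers at the two ends of the image are free of charge when the
    pivot a belongs to K, since elements of <K> may be stripped off. *)
Lemma whitehead_shortens K (D : pred letter) a x u : D a -> ~~ D (linv a) ->
  (forall z, z.1 \in K -> D z -> z = a) ->
  (crossings D x u + (if a.1 \in K then 0 else D x + D (linv (last x u))) < occ a.1 (x :: u))%N ->
  exists al be h h', [/\ aut_fixing K al be, word_over (mem K) h, word_over (mem K) h' &
    (size (fgword (elt h * al (elt (x :: u)) * elt h')%g) < size (x :: u))%N].
Proof.
move=> Da Dl DK lt_occ.
have [v [ev sv]] := whitehead_word x u Da Dl.
set A := elt [:: a] in ev; set D' := fun z => _ in ev.
exists (whitehead A D'), (whitehead A^-1 D').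
have fx : aut_fixing K (whitehead A D') (whitehead A^-1 D').
  apply: whitehead_aut_fixing; rewrite /D' ?eqxx ?andbF ?(negPf Dl) //.
  by move=> z /DK zK; case Dz: (D z) => //=; rewrite zK ?eqxx.
case: ifP lt_occ => [aK|aK] lt_occ.
  exists (if D x then [:: linv a] else [::]), (if D (linv (last x u)) then [:: a] else [::]).
  split=> //; try by case: ifP => //= _; rewrite aK.
  have -> : elt (if D x then [:: linv a] else [::]) * whitehead A D' (elt (x :: u)) *
     elt (if D (linv (last x u)) then [:: a] else [::]) = elt v.
    rewrite ev; case: (D x); case: (D _);
      rewrite /= ?elt_nil ?elt_linv ?invg1 ?mulg1 ?mul1g -/A ?mulgVK ?mulKg //.
    by rewrite -!mulgA mulKg mulVg mulg1.
  by apply: leq_ltn_trans (size_elt v) _; move: lt_occ sv; clear; lia.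
exists [::], [::]; split=> //; rewrite elt_nil mul1g mulg1 ev.
have sA : size (fgword A) = 1%N by rewrite fgword_letter.
have sV : size (fgword A^-1) = 1%N by rewrite -elt_linv fgword_letter.
have sg (e : bool) : (size (fgword (gpow A e)) <= e)%N by case: e => //=; rewrite sA.
have sgV (e : bool) : (size (fgword (gpow A e)^-1) <= e)%N.
  by case: e => //=; rewrite ?sV // invg1.
apply: leq_ltn_trans (size_mul _ _) _.
have := size_mul (gpow A (D x)) (elt v).
move: (size_elt v) (sg (D x)) (sgV (D (linv (last x u)))) lt_occ sv.
set s1 := size _; set s2 := size _; set s3 := size _; set s4 := size (fgword (_ * _)).
clear; lia.
Qed.

End Automorphisms.

(** * Shortening along a closed set of letters *)

Section Reduction.
Variables (I : choiceType) (K : seq I).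
Local Notation letter := (I * bool)%type.
Local Notation F := (free_group I).
Implicit Types (s u v w : seq letter) (a b x y z : letter) (g : F).

(** An automorphism fixing K and multiplication by elements of <K> on both
    sides change neither the hypothesis nor the conclusion of
    completes_of_all_products. *)
Definition shortenable g (n : nat) := exists al be h h',
  [/\ aut_fixing K al be, word_over (mem K) h, word_over (mem K) h' &
    (size (fgword (elt h * al g * elt h')%g) < n)%N].

Lemma turnsP x u p q : (p, q) \in turns x u -> infix [:: linv p; q] (x :: u).
Proof.
rewrite /turns; elim: u x => //= y u IHu x; rewrite inE => /orP[/eqP[-> ->]|/IHu].
  by rewrite linvK !eqxx prefix0s.
by move=> inf; rewrite [X in _ || X]inf orbT.
Qed.

(** Every occurrence of the generator of t puts a turn at the vertex t, except
    when it is at an end of the word. *)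
Lemma occ_turns t x u : (occ t.1 (x :: u) = (x == t) + (linv (last x u) == t) +
  (count (fun yz => yz.1 == t) (turns x u) + count (fun yz => yz.2 == t) (turns x u)))%N.
Proof.
have one y : ((y.1 == t.1) = (y == t) + (linv y == t) :> nat)%N.
  case: y t => [i b] [j c]; rewrite /linv /= !xpair_eqE; case: (i == j) => //=.
  by case: b; case: c.
elim: u x => [|y u IHu] x; first by rewrite /occ /= !addn0 one.
have -> : occ t.1 [:: x, y & u] = ((x.1 == t.1) + occ t.1 (y :: u))%N by [].
by rewrite IHu one /=; lia.
Qed.

(** If D separates only turns at the vertex t, the number of occurrences of t
    and its inverse exceeds the number of separated turns by at least the
    number of turns at t that are not separated, plus the number of ends at t. *)
Lemma crossings_at t (D : pred letter) x u :
  (forall p q, (p, q) \in turns x u -> D p != D q -> (p == t) || (q == t)) ->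
  (crossings D x u +
    count (fun yz => (D yz.1 == D yz.2) && ((yz.1 == t) || (yz.2 == t))) (turns x u)
    + (x == t) + (linv (last x u) == t) <= occ t.1 (x :: u))%N.
Proof.
rewrite occ_turns /crossings; elim: (turns x u) => [|[p q] T IHT] H /=; first by lia.
have /IHT : forall p q, (p, q) \in T -> D p != D q -> (p == t) || (q == t).
  by move=> p' q' pq; apply: H; rewrite inE pq orbT.
have : (D p == D q) || ((p == t) || (q == t)).
  by have := H p q; rewrite inE eqxx => /(_ isT); case: (D p == D q) => //= ->.
by case: (D p == D q); case: (p == t); case: (q == t) => //= _; lia.
Qed.

Lemma const_along (D : pred letter) x u :
  (forall p q, (p, q) \in turns x u -> D p = D q) ->
  (forall z, z \in x :: u -> D (linv z) = D z) -> forall z, z \in x :: u -> D z = D x.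
Proof.
elim: u x => [|y u IHu] x cl sym z; first by rewrite inE => /eqP->.
rewrite inE => /orP[/eqP->//|zu].
have -> : D z = D y.
  apply: IHu => // [p q pq|z' z'u]; first by apply: cl; rewrite inE pq orbT.
  by apply: sym; rewrite inE z'u orbT.
by rewrite -(cl (linv x) y) ?inE ?eqxx // sym // inE eqxx.
Qed.

(** If no turn inside the word leaves D, and not both ends of the word are in D,
    then D does not contain the inverse of some a in D whose generator occurs:
    otherwise D could not be left along the word.  The Whitehead automorphism
    for D and a removes all occurrences of a and adds at most one letter, at an
    end.  Thus it shortens the word, unless a occurs only once. *)
Lemma closed_side (D : pred letter) x u z :
  (forall p q, (p, q) \in turns x u -> D p = D q) ->
  (forall y, D y -> y.1 \notin K) -> D z -> z.1 \in map fst (x :: u) ->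
  ~~ (D x && D (linv (last x u))) ->
  completes K (elt (x :: u)) \/ shortenable (elt (x :: u)) (size (x :: u)).
Proof.
move=> cl DK Dz zs ends.
have [/hasP[b bs Db]|/hasPn nob] := boolP (has (fun b => D b != D (linv b)) (x :: u)); last first.
  case/negP: ends.
  have sym b : b \in x :: u -> D (linv b) = D b by move=> /nob; rewrite negbK => /eqP.
  have all_x := const_along cl sym.
  have Dx : D x.
    case/mapP: zs => b bs ezb; rewrite -(all_x b bs).
    have [<-//|ez] := eq_or_linv ezb.
    by rewrite -sym // -ez.
  by rewrite Dx sym ?all_x ?mem_last.
have [a [Da Dl eab]] : exists a, [/\ D a, ~~ D (linv a) & a.1 = b.1].
  case E: (D b) Db => /= Db; [exists b | exists (linv b)]; split => //.
    by case: (D (linv b)) Db.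
  by rewrite linvK E.
have occ_gt0 : (0 < occ a.1 (x :: u))%N.
  by rewrite /occ -has_count; apply/hasP; exists b => //; rewrite eab.
have aK := DK a Da.
have no_cross : crossings D x u = 0%N.
  apply/eqP; rewrite /crossings -leqn0 leqNgt -has_count; apply/hasPn => -[p q] /cl /= ->.
  by rewrite eqxx.
have [occ2|occ1] := ltnP 1 (occ a.1 (x :: u)).
  right; apply: (@whitehead_shortens _ K D a x u) => // [y yK /DK|].
    by rewrite yK.
  rewrite no_cross (negPf aK) add0n; apply: leq_ltn_trans occ2.
  by move: ends; case: (D x); case: (D _).
left.
have {bs} [s [s' es]] : exists s s', x :: u = s ++ b :: s'.
  by case/splitPr: bs => s s'; exists s, s'.
move: occ1; rewrite es /occ count_cat /= eab eqxx => occ1.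
have solo t : count (fun z => z.1 == b.1) t = 0%N -> word_over (predC1 b.1) t.
  move=> c0; rewrite /word_over; apply/allP => y yt /=; apply/negP => yb.
  have : has (fun z => z.1 == b.1) t by apply/hasP; exists y.
  by rewrite has_count c0.
rewrite elt_cat (elt_cons b) mulgA; apply: completes_solo; rewrite -?eab //.
  by rewrite eab; apply: solo; move: occ1; clear; lia.
by rewrite eab; apply: solo; move: occ1; clear; lia.
Qed.

End Reduction.

(** * Completing a set of generators by one element *)

Definition conj_by (G : groupType) (h g : G) := g ^ h.

HB.instance Definition _ (G : groupType) (h : G) :=
  isMultiplicative.Build G G (conj_by h) (fun x y => conjMg x y h).

Section Extension.
Variables (I : choiceType) (K : seq I).
Local Notation letter := (I * bool)%type.
Local Notation F := (free_group I).
Implicit Types (s u v w : seq letter) (a b x y z : letter) (g : F).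

Lemma infix_flatten (T : eqType) (s : seq T) ss : s \in ss -> infix s (flatten ss).
Proof.
by case/splitPr=> s1 s2; rewrite flatten_cat /= infix_infix.
Qed.

Lemma reduced_positive w : all snd w -> reduced w.
Proof.
case: w => //= a w; elim: w a => //= b w IHw a /and3P[a2 b2 w2].
rewrite /= IHw ?b2 // andbT; apply/eqP => e.
by move: b2; rewrite e /= a2.
Qed.

(** As its letters are positive, this word is reduced, and its Whitehead graph
    contains an edge from (i, false) to (j, true) for all i and j in K. *)
Definition pairs_word := flatten [seq [:: (i, true); (j, true)] | i <- K, j <- K].

Lemma pairs_word_infix i j : i \in K -> j \in K -> infix [:: (i, true); (j, true)] pairs_word.
Proof.
by move=> iK jK; apply/infix_flatten/(allpairs_f (fun i j => [:: (i, true); (j, true)])).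
Qed.

Lemma pairs_word_positive a : a \in pairs_word -> a.2 && (a.1 \in K).
Proof.
case/flattenP => s /allpairsP[[i j] /= [iK jK ->]].
by rewrite !inE => /orP[] /eqP->.
Qed.

(** A complete bipartite graph with sides of equal size stays connected when a
    vertex is deleted. *)
Lemma bipartite_const (P : pred letter) t :
  (forall i j, i \in K -> j \in K -> (i, false) != t -> (j, true) != t ->
    P (i, false) = P (j, true)) ->
  forall y z, y.1 \in K -> z.1 \in K -> y != t -> z != t -> P y = P z.
Proof.
move=> cl [i b] [j c] /= iK jK it jt.
case: (eqVneq i j) it => [->|ij] it.
  by case: b it; case: c jt => // jt it; by rewrite (cl j j).
case: b it; case: c jt => // jt it; [|by rewrite (cl j i)|by rewrite (cl i j)|].
  have [e|ne] := eqVneq (i, false) t.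
    rewrite -(cl j i) -?(cl j j) // -e xpair_eqE eq_sym ?(negPf ij) //.
  by rewrite -(cl i i) -?(cl i j).
have [e|ne] := eqVneq (i, true) t.
  by rewrite (cl i j) ?(cl j j) // -e xpair_eqE eq_sym ?(negPf ij).
by rewrite (cl i i) ?(cl j i).
Qed.

(** The cut vertex t of the Whitehead graph of u w, w being pairs_word, leaves
    all letters over K on one side; D is the rest.  The turns inside u then
    leave D only through t, and an end of u can be in D only if t is the letter
    over K met there.  According to whether D contains linv t, the Whitehead
    automorphism for D with pivot linv t, or for D with t added and pivot t, is
    tried; if it does not shorten u, then no turn inside u leaves D with t
    added, or D respectively, so that closed_side applies. *)
Lemma completes_or_shortenable i0 x u : i0 \in K -> x.1 \notin K -> (last x u).1 \notin K ->
  reduced (x :: u) -> retract_primitive (elt ((x :: u) ++ pairs_word)) ->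
  completes K (elt (x :: u)) \/ shortenable K (elt (x :: u)) (size (x :: u)).
Proof.
move=> i0K xK yK rxu gd; set y := last x u in yK *.
have [b [w' [e [w'' [ew ew' b2 e2]]]]] : exists b w' e w'',
  [/\ pairs_word = b :: w', pairs_word = rcons w'' e, b.2 && (b.1 \in K) & e.2 && (e.1 \in K)].
  have := pairs_word_infix i0K i0K; move: pairs_word_positive.
  case: pairs_word => [|b w'] pos; first by move=> /=.
  move=> _; exists b, w', (last b w'), (belast b w').
  by split; rewrite -?lastI //; apply: pos; rewrite ?mem_head ?mem_last.
move: b2 e2; case: b e ew ew' => [i1 [|]] [i2 [|]] //= ew ew' i1K i2K.
set W := (x :: u) ++ pairs_word in gd.
have rp : reduced pairs_word.
  by apply: reduced_positive; apply/allP => a /pairs_word_positive /andP[].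
have neK a c : a.1 \notin K -> c.1 \in K -> a == c = false.
  by move=> aK cK; apply: contraNF aK => /eqP->.
have rWW : reduced (W ++ W).
  have rW : reduced W.
    rewrite /W ew lastI reduced_cat_cons -lastI rxu -ew rp andbT /=.
    by rewrite eq_sym neK.
  have r2 : reduced (pairs_word ++ x :: u).
    by rewrite ew' reduced_cat_cons -ew' rp rxu andbT /= neK.
  have pw0 : pairs_word <> [::] by rewrite ew.
  by rewrite {1}/W -catA; apply: reduced_glue => //; apply: reduced_glue.
have WK a : a \in W -> a.1 \in K ++ map fst (x :: u).
  rewrite /W mem_cat mem_cat => /orP[au|/pairs_word_positive/andP[_ ->]] //.
  by rewrite (map_f fst au) orbT.
set G := K ++ map fst (x :: u) in WK.
have GW : word_over (mem G) W by apply/allP => a /WK.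
apply: NNPP => nogoal.
apply: (@whitehead_cut I G W i0 x.1) => //.
- by rewrite /G mem_cat i0K.
- by rewrite /G mem_cat /= mem_head orbT.
- by apply: contraNneq xK => <-.
move=> t Gt P cl z1 z2 G1 G2 n1 n2; apply/eqP/negPn/negP => neq; apply: nogoal.
have iW s : infix s pairs_word -> infix s (W ++ W).
  by move=> inf; rewrite /W -catA; apply/infix_catl/infix_catr.
have iu s : infix s (x :: u) -> infix s (W ++ W).
  by move=> inf; rewrite /W -!catA; apply/infix_catr.
have Kconst : forall y z, y.1 \in K -> z.1 \in K -> y != t -> z != t -> P y = P z.
  apply: bipartite_const => i j iK jK it jt.
  by apply: (cl (i, true) (j, true)) => //; apply/iW/pairs_word_infix.
have [k [kK kt]] : exists k : letter, k.1 \in K /\ k != t.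
  have [e|ne] := eqVneq (i0, true) t; last by exists (i0, true).
  by exists (i0, false); rewrite -e xpair_eqE andbF.
pose D z := [&& z.1 \in G, z != t & P z != P k].
have DK z : D z -> z.1 \notin K.
  by case/and3P=> _ zt; apply: contraNN => zK; rewrite (Kconst z k).
have Dt : D t = false by rewrite /D eqxx andbF.
have [z Dz] : exists z, D z.
  have [e|ne] := eqVneq (P z1) (P k); [exists z2|exists z1]; apply/and3P; split=> //.
  by rewrite -e eq_sym.
have cl' p q : (p, q) \in turns x u -> p != t -> q != t -> D p = D q.
  move=> pq pt qt; rewrite /D pt qt /=.
  have inf := turnsP pq.
  have <- : P p = P q by rewrite -(linvK p); apply: cl; rewrite ?linvK //; apply: iu.
  have [Gp Gq] : p.1 \in G /\ q.1 \in G.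
    have sub := mem_infix inf; rewrite /G !mem_cat.
    split; apply/orP; right.
      by apply: (@map_f _ _ fst _ (linv p)); apply: sub; rewrite mem_head.
    by apply: (@map_f _ _ fst _ q); apply: sub; rewrite !inE eqxx orbT.
  by rewrite Gp Gq.
(* The junction of u with w is an edge from linv y to the first letter of w,
   that of w with u an edge from x to the inverse of the last letter.  Both
   letters of w are positive, so t is not met at both junctions. *)
have Dy : D (linv y) -> t = (i1, true).
  move=> /and3P[_ yt Py]; apply/eqP; rewrite eq_sym; apply: contraNT Py => it.
  rewrite -(Kconst (i1, true) k) //; apply/eqP; apply: (cl y (i1, true)) => //.
  rewrite /cyclic_turn {1}/W ew (lastI x u) -/y cat_rcons -catA; apply: infix_catl.
  by rewrite /= !eqxx prefix0s.
have Dx : D x -> t = (i2, false).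
  move=> /and3P[_ xt Px]; apply/eqP; rewrite eq_sym; apply: contraNT Px => it.
  rewrite -(Kconst (i2, false) k) // eq_sym; apply/eqP; apply: (cl (i2, true) x) => //.
  rewrite /cyclic_turn {1}/W ew' -catA cat_rcons catA; apply: infix_catl.
  by rewrite /W /= !eqxx prefix0s.
have DxtK : t.1 \notin K -> D x = false.
  by move=> tK; apply/negP => /Dx e; rewrite e /= i2K in tK.
have DytK : t.1 \notin K -> D (linv y) = false.
  by move=> tK; apply/negP => /Dy e; rewrite e /= i1K in tK.
have zu : z.1 \in map fst (x :: u).
  by case/and3P: (Dz); rewrite mem_cat (negPf (DK _ Dz)).
pose Dp z := D z || (z == t).
have xtK : t.1 \in K -> (x == t = false) * (linv y == t = false).
  by move=> tK; rewrite !neK.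
(* nc counts the turns at t that are not separated. *)
have [Dlt|nDlt] := boolP (D (linv t)).
  have tK : t.1 \notin K := DK _ Dlt.
  have cross p q : (p, q) \in turns x u -> D p != D q -> (p == t) || (q == t).
    move=> pq; apply: contraNT; rewrite negb_or => /andP[pt qt].
    by rewrite (cl' p q).
  have := crossings_at cross.
  set nc := count _ (turns x u); rewrite -/y => le_occ.
  have [strict|nstrict] := boolP (0 < nc + (x == t) + (linv y == t))%N.
    right; apply: (@whitehead_shortens _ K D (linv t)) => //; first by rewrite linvK Dt.
      by move=> v vK /DK; rewrite vK.
    rewrite -[(linv t).1]/t.1 (negPf tK) -/y DxtK // DytK //.
    by apply: (leq_trans _ le_occ); move: strict; clear; lia.
  have [nc0 xt yt] : [/\ nc = 0%N, x == t = false & linv y == t = false].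
    by move: nstrict; case: (x == t); case: (linv y == t); case: (nc).
  have nonc p q : (p, q) \in turns x u -> (p == t) || (q == t) -> D p != D q.
    move=> pq ptq; apply/negP => Dpq.
    have : has (fun yz => (D yz.1 == D yz.2) && ((yz.1 == t) || (yz.2 == t))) (turns x u).
      by apply/hasP; exists (p, q); rewrite //= Dpq ptq.
    by rewrite has_count -/nc nc0.
  apply: (@closed_side _ K Dp x u z) => //.
  - move=> p q pq; rewrite /Dp; have := nonc p q pq; have := cl' p q pq.
    have [->|pt] := eqVneq p t; have [->|qt] := eqVneq q t; rewrite ?Dt ?orbT ?orbF //=.
    + by move=> _ /(_ isT); case: (D q).
    + by move=> _ /(_ isT); case: (D p).
    + by move=> /(_ isT isT).
  - by move=> v /orP[/DK//|/eqP->].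
  - by rewrite /Dp Dz.
  - by rewrite /Dp DxtK // xt.
have cross p q : (p, q) \in turns x u -> Dp p != Dp q -> (p == t) || (q == t).
  move=> pq; apply: contraNT; rewrite negb_or => /andP[pt qt].
  by rewrite /Dp (cl' p q) // (negPf pt) (negPf qt).
have := crossings_at cross.
set nc := count _ (turns x u); rewrite -/y => le_occ.
have [strict|nstrict] := boolP (0 < nc)%N.
  right; apply: (@whitehead_shortens _ K Dp t) => //.
  - by rewrite /Dp eqxx orbT.
  - by rewrite /Dp negb_or nDlt linv_neq.
  - by move=> v vK /orP[/DK|/eqP//]; rewrite vK.
  rewrite -/y; case: ifP => [_|/negbT tK].
    by apply: (leq_trans _ le_occ); move: strict; clear; lia.
  rewrite /Dp DxtK // DytK // !orFb.
  by apply: (leq_trans _ le_occ); rewrite addnA !ltn_add2r -[X in (X < _)%N]addn0 ltn_add2l.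
have nonc p q : (p, q) \in turns x u -> (p == t) || (q == t) -> Dp p != Dp q.
  move=> pq ptq; apply: contraNN nstrict => Dpq.
  by rewrite -has_count; apply/hasP; exists (p, q); rewrite //= Dpq ptq.
apply: (@closed_side _ K D x u z) => //.
- move=> p q pq; have := nonc p q pq; have := cl' p q pq; rewrite /Dp.
  have [->|pt] := eqVneq p t; have [->|qt] := eqVneq q t; rewrite ?Dt ?orbT ?orbF //=.
  + by move=> _ /(_ isT); case: (D q).
  + by move=> _ /(_ isT); case: (D p).
  + by move=> /(_ isT isT).
- by apply/negP => /andP[/Dx e /Dy e']; move: e; rewrite e'.
Qed.

Lemma retract_primitive_aut (al be : {multiplicative F -> F}) g :
  cancel al be -> cancel be al -> retract_primitive g -> retract_primitive (al g).
Proof.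
move=> ab ba [J [th [et [j [thK e]]]]].
exists J, (th \o be), (al \o et), j; split; first exact: can_comp.
by rewrite /= ab.
Qed.

Lemma retract_primitive_conj g h : retract_primitive g -> retract_primitive (h^-1 * g * h).
Proof.
rewrite -mulgA; apply: (@retract_primitive_aut (conj_by h) (conj_by h^-1)) => x.
  exact: conjgK.
exact: conjgKV.
Qed.

(** Letters over K at the ends of g can be stripped off, because the products
    g h with h in <K> are, up to conjugation by <K>, the same for the stripped
    element.  Then completes_or_shortenable applies. *)
Lemma completes_of_all_products i0 g : i0 \in K ->
  (forall h, word_over (mem K) h -> retract_primitive (g * elt h)) -> completes K g.
Proof.
move=> i0K; have [n] := ubnP (size (fgword g)); elim: n g => // n IHn g lt_n gd.
case E: (fgword g) => [|x u].
  have [J [th [et [j [_]]]]] := gd [::] isT.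
  by rewrite -(elt_fgword g) E elt_nil mulg1 hom1 => /(congr1 (@fgword J)).
have eg : g = elt (x :: u) by rewrite -(elt_fgword g) E.
have [xK|xK] := boolP (x.1 \in K).
  have -> : g = elt [:: x] * elt u * elt [::] by rewrite elt_nil mulg1 -elt_cat.
  apply: completes_mul; rewrite //= ?xK //; apply: IHn.
    by apply: leq_ltn_trans (size_elt u) _; move: lt_n; rewrite E.
  move=> h Kh; have /retract_primitive_conj : retract_primitive (g * elt (rcons h (linv x))).
    by apply: gd; rewrite word_over_rcons Kh andbT.
  move=> /(_ (elt [:: x])); congr retract_primitive.
  by rewrite eg (elt_cons x u) -cats1 elt_cat elt_linv -!mulgA mulKg mulVg mulg1.
have [yK|yK] := boolP ((last x u).1 \in K).
  have es : g = elt (belast x u) * elt [:: last x u].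
    by rewrite -elt_cat cats1 -lastI.
  have -> : g = elt [::] * elt (belast x u) * elt [:: last x u] by rewrite elt_nil mul1g.
  apply: completes_mul; rewrite //= ?yK //; apply: IHn.
    by apply: leq_ltn_trans (size_elt _) _; move: lt_n; rewrite E size_belast.
  move=> h Kh; have -> : elt (belast x u) * elt h = g * elt (linv (last x u) :: h).
    by rewrite es (elt_cons (linv _) h) elt_linv -!mulgA mulVKg.
  by apply: gd; rewrite /= yK.
have [||//|[al [be [h [h' [fx Kh Kh' lt]]]]]] := completes_or_shortenable i0K xK yK.
- by rewrite -E reduced_fgword.
- rewrite elt_cat -eg; apply: gd; apply/allP => a.
  by move/pairs_word_positive/andP => [].
- by rewrite eg.
rewrite -eg in lt; apply: (completes_aut fx).
have -> : al g = elt (winv h) * (elt h * al g * elt h') * elt (winv h').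
  by rewrite !elt_winv !mulgA mulVg mul1g mulgK.
apply: completes_mul; rewrite ?word_over_winv //; apply: IHn.
  by apply: leq_trans lt _; move: lt_n; rewrite E.
move=> h1 Kh1; have [ab ba fa] := fx.
have := retract_primitive_aut ab ba (gd (h' ++ h1 ++ h) _).
rewrite !word_over_cat Kh Kh' Kh1 => /(_ isT) /(@retract_primitive_conj _ (elt h)^-1).
rewrite gmulfM (hom_fix fa) ?word_over_cat ?Kh ?Kh' ?Kh1 // !elt_cat invgK.
by rewrite !mulgA mulgK.
Qed.

End Extension.

(** * The rank one case and the induction on generators *)

Section OneMoreLetter.
Variable I : choiceType.
Local Notation F := (free_group I).

Definition add_letter (J : choiceType) : {multiplicative free_group J -> free_group (option J)} :=
  fg_eval (fun i => fg_gen (Some i)).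

Definition kill_letter (J : choiceType) : {multiplicative free_group (option J) -> free_group J} :=
  fg_eval (fun o => oapp (@fg_gen J) 1 o).

Definition power_word (J : choiceType) (e : seq bool) : seq (option J * bool) :=
  [seq (None, c) | c <- e].

Lemma hom_power_word (J J' : choiceType)
    (h : {multiplicative free_group (option J) -> free_group (option J')}) e :
  h (fg_gen None) = fg_gen None -> h (elt (power_word J e)) = elt (power_word J' e).
Proof.
move=> hN; elim: e => [|c e IHe]; first by rewrite /= !elt_nil hom1.
rewrite /power_word /= (elt_cons (None, c)) gmulfM IHe [RHS]elt_cons; congr (_ * _).
by case: c; rewrite !elt1 ?homV hN.
Qed.

(** The letter j that g becomes is replaced by j Y^-1, where Y is the given power
    of the new letter; then g Y becomes j. *)
Lemma retract_primitive_add_letter (g : F) e :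
  retract_primitive g -> retract_primitive (add_letter I g * elt (power_word I e)).
Proof.
move=> [J [th [et [j [thK thg]]]]].
set Y := elt (power_word I e); pose H := elt (power_word J e).
pose sg : {multiplicative free_group J -> free_group (option J)} :=
  fg_eval (fun k => if k == j then fg_gen (Some j) * H^-1 else fg_gen (Some k)).
pose th' : {multiplicative free_group (option I) -> free_group (option J)} :=
  fg_eval (fun o => if o is Some i then sg (th (fg_gen i)) else fg_gen None).
pose et' : {multiplicative free_group (option J) -> free_group (option I)} :=
  fg_eval (fun o => if o is Some k then
    (if k == j then add_letter I g * Y else add_letter I (et (fg_gen k))) else fg_gen None).
have thN : th' (fg_gen None) = fg_gen None by rewrite /th' /= fg_eval_gen.
have etN : et' (fg_gen None) = fg_gen None by rewrite /et' /= fg_eval_gen.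
have thY : th' Y = H by exact: hom_power_word.
have etH : et' H = Y by exact: hom_power_word.
have et_sg k : et' (sg k) = add_letter I (et k).
  apply: (@hom_eq _ _ (et' \o sg) (add_letter I \o et)) => {}k /=.
  rewrite /sg /= fg_eval_gen; case: eqP => [->|/eqP kj].
    rewrite gmulfM homV etH /et' /= fg_eval_gen eqxx mulgK.
    by congr (fg_eval _ _); rewrite -thg thK.
  by rewrite /et' /= fg_eval_gen (negPf kj).
have th_add x : th' (add_letter I x) = sg (th x).
  apply: (@hom_eq _ _ (th' \o add_letter I) (sg \o th)) => i /=.
  by rewrite /add_letter /= fg_eval_gen /th' /= fg_eval_gen.
exists (option J), th', et', (Some j); split.
  apply: cancel_gen => -[i|]; last by rewrite thN etN.
  rewrite {1}/th' /= fg_eval_gen et_sg thK.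
  by rewrite /add_letter /= fg_eval_gen.
by rewrite gmulfM thY th_add thg /sg /= fg_eval_gen eqxx mulgVK.
Qed.

(** The automorphism obtained in the larger group fixes the new letter, so it
    descends to the quotient in which that letter is trivial. *)
Lemma retract_primitive_completes (g : F) : retract_primitive g -> completes [::] g.
Proof.
move=> gd; have [|h|] := @completes_of_all_products _ [:: None] None (add_letter I g).
- exact: mem_head.
- move=> Yh; have -> : h = power_word I [seq a.2 | a <- h].
    elim: h Yh => [|[i c] h IHh] //= /andP[]; rewrite inE => /eqP-> /IHh {1}->.
    by [].
  exact: retract_primitive_add_letter.
move=> al [be [[j|] [[ab ba fa] jN e]]]; last by rewrite mem_head in jN.
have faN : al (fg_gen None) = fg_gen None by apply: fa; rewrite mem_head.
have fbN : be (fg_gen None) = fg_gen None by rewrite -{1}faN ab.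
have killN : kill_letter I (fg_gen None) = 1 by rewrite /kill_letter /= fg_eval_gen.
have kill_add x : kill_letter I (add_letter I x) = x.
  move: x; apply: cancel_gen => i.
  by rewrite /add_letter /= fg_eval_gen /kill_letter /= fg_eval_gen.
have descend (h : {multiplicative free_group (option I) -> free_group (option I)}) x :
    h (fg_gen None) = fg_gen None ->
    kill_letter I (h (add_letter I (kill_letter I x))) = kill_letter I (h x).
  move=> hN; apply: (@hom_eq _ _ (kill_letter I \o h \o add_letter I \o kill_letter I)
    (kill_letter I \o h)).
  move=> [i|] /=; last by rewrite killN !hom1 hN killN.
  congr (fg_eval _ (h _)).
  by rewrite /kill_letter /= fg_eval_gen /add_letter /= fg_eval_gen.
exists (kill_letter I \o al \o add_letter I), (kill_letter I \o be \o add_letter I), j.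
split=> //; last by rewrite /= e /kill_letter /= fg_eval_gen.
split=> // x /=; by rewrite descend // ?ab ?ba kill_add.
Qed.

End OneMoreLetter.

Section Primitive.
Variable I : choiceType.
Local Notation F := (free_group I).

(** The free group on the set F of all elements serves for every basis B: mapping
    each b in B to the letter b embeds F, and evaluation of words retracts. *)
Lemma primitive_retract_primitive (v : F) : primitive_elt v -> retract_primitive v.
Proof.
move=> [B fB Bv].
have [[th thB] _] := fB (free_group F) (@fg_gen F).
have [_ uniqB] := fB F id.
pose et : {multiplicative free_group F -> F} := fg_eval id.
exists F, th, et, v; split; last exact: thB.
apply: (uniqB (et \o th) idfun) => b Bb /=.
by rewrite thB // /et /= fg_eval_gen.
Qed.

Lemma primitive_aut (al be : {multiplicative F -> F}) v :
  cancel al be -> cancel be al -> primitive_elt v -> primitive_elt (al v).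
Proof.
move=> ab ba [B fB Bv]; exists (fun b => B (be b)); last by rewrite ab.
move=> H f; have [[h hB] uniqB] := fB H (f \o al); split.
  by exists (h \o be) => b Bb; rewrite /= hB //= ba.
move=> h1 h2 eq_h x; rewrite -(ba x); apply: (uniqB (h1 \o al) (h2 \o al)) => b Bb /=.
by apply: eq_h; rewrite ab.
Qed.

Lemma primitive_gen (i : I) : primitive_elt (@fg_gen I i).
Proof. by exists (fun u => exists i, u = fg_gen i); [exact: fg_gen_free_basis|exists i]. Qed.

(** This element is the image of a letter under an automorphism, by
    completes_solo with no letter to be fixed. *)
Lemma primitive_solo (i : I) (w : seq (I * bool)) :
  word_over (predC1 i) w -> primitive_elt (fg_gen i * elt w).
Proof.
move=> iw; have [|al [be [j [[ab ba _] _ e]]]] := @completes_solo I [::] [::] (i, true) w isT isT.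
  exact: iw.
rewrite elt_nil mul1g elt1 in e; rewrite -(ab (_ * _)) e.
by apply: primitive_aut ba ab _; apply: primitive_gen.
Qed.

(** The induction on the generators already treated; f records the generators
    they are sent to. *)
Lemma straighten (phi : {multiplicative F -> F}) (L : seq I) :
  primitivity_preserving phi -> uniq L ->
  exists (al be : {multiplicative F -> F}) (f : I -> I),
    [/\ cancel al be, cancel be al, {in L &, injective f} &
        forall i, i \in L -> al (phi (fg_gen i)) = fg_gen (f i)].
Proof.
move=> hphi; elim: L => [|i L IHL] /=; first by move=> _; exists idfun, idfun, id; split.
move=> /andP[iL /IHL [al [be [f [ab ba f_inj fL]]]]].
have [al' [be' [j [[ab' ba' fa'] jK e]]]] : completes (map f L) (al (phi (fg_gen i))).
  case: L iL f_inj fL {IHL} => [|i1 L] iL f_inj fL.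
    apply/retract_primitive_completes/(retract_primitive_aut ab ba).
    apply/primitive_retract_primitive/hphi/primitive_gen.
  apply: (@completes_of_all_products _ _ (f i1)); first by rewrite mem_head.
  (* Every h over map f L is the image of some w over L, so the product is the
     image of the primitive element x_i w. *)
  move=> h Kh; have [w Lw ew] : exists2 w, word_over (mem (i1 :: L)) w & al (phi (elt w)) = elt h.
    elim: h Kh => [|[k c] h IHh]; first by exists [::]; rewrite ?elt_nil ?hom1.
    case/andP; rewrite [_ (k, c).1]/(k \in map f (i1 :: L)).
    move=> /mapP[l lL ->] /IHh [w Lw ew]; exists ((l, c) :: w).
      by apply/andP.
    rewrite (elt_cons (l, c) w) !gmulfM ew [RHS]elt_cons; congr (_ * _).
    by case: c; rewrite !elt1 ?homV fL.
  rewrite -ew -!gmulfM; apply/(retract_primitive_aut ab ba)/primitive_retract_primitive.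
  apply/hphi/primitive_solo.
  by apply: sub_all Lw => a /= aL; apply: contraNneq iL => <-.
exists (al' \o al), (be \o be'), (fun k => if k == i then j else f k).
split; [exact: can_comp|exact: can_comp| |].
- have fN k : k \in L -> j <> f k by move=> kL ej; rewrite ej map_f in jK.
  move=> k l; rewrite !inE; case: (eqVneq k i) => [->|ki] /=;
    case: (eqVneq l i) => [->|li] //= kL lL.
  + by move/fN.
  + by move/esym/fN.
  + exact: f_inj.
move=> k; rewrite inE /=; case: eqP => [-> _|_ /= kL]; first by rewrite e.
by rewrite fL // fa' // map_f.
Qed.

End Primitive.

Theorem mainTheorem1 (n : nat) (hn : (3 <= n)%N)
    (phi : {multiplicative free_group 'I_n -> free_group 'I_n})
    (hphi : primitivity_preserving phi) :
  bijective phi.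
Proof.
have [al [be [f [ab ba f_inj fE]]]] := straighten hphi (enum_uniq 'I_n).
have [f' fK f'K] : bijective f.
  by apply: injF_bij => i j; apply: f_inj; rewrite mem_enum.
pose psi : {multiplicative free_group 'I_n -> free_group 'I_n} :=
  fg_eval (fun i => fg_gen (f' i)).
have psiE i : psi (fg_gen i) = fg_gen (f' i) by rewrite /psi /= fg_eval_gen.
have phiE i : al (phi (fg_gen i)) = fg_gen (f i) by apply: fE; rewrite mem_enum.
have K1 : cancel (al \o phi) psi by apply: cancel_gen => i /=; rewrite phiE psiE fK.
have K2 : cancel psi (al \o phi) by apply: cancel_gen => i /=; rewrite psiE phiE f'K.
exists (psi \o al) => x; first exact: K1.
exact: (can_inj ab (K2 (al x))).
Qed.
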